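(* Let $m,n$ be positive integers and let $\mathcal{R}=(r_1,\ldots,r_m)$, $\mathcal{C}=(c_1,\ldots,c_n)$ be sequences of integers with $n=r_1\ge r_2\ge\cdots\ge r_m$ and $m=c_1\ge c_2\ge\cdots\ge c_n$, and assume that $(\mathcal{R},\mathcal{C})$ is consistent. Let $\alpha=\alpha(\mathcal{R},\mathcal{C})$ and let $F_2$ be the set produced by the procedure described in the context. Then \[ L_h(F_2)\le 2n+2\alpha,\qquad L_v(F_2)\le 2m+2\alpha. \]
   Context: For a finite set $F\subseteq\mathbb{Z}^2$, row $i$ is $\{(i,l)\}$ and column $j$ is $\{(k,j)\}$ (matrix convention). The row sum $r_i$ is the number of points of $F$ in row $i$ and the column sum $c_j$ the number of points of $F$ in column $j$. The pair $(\mathcal{R},\mathcal{C})$ is consistent if there exists $F\subseteq\{1,\ldots,m\}\times\{1,\ldots,n\}$ with these row and column sums. Let $b_i=\#\{j:c_j\ge i\}$ and $\alpha(\mathcal{R},\mathcal{C})=\frac12\sum_{i=1}^m|r_i-b_i|$. The uniquely determined neighbour is $F_1=\{(i,j):1\le j\le n,\ 1\le i\le c_j\}$. Boundary: $L_h(F)$ is the number of ordered pairs $((i,j),(i',j'))$ of points of $\mathbb{Z}^2$ with $|i-i'|=1$, $j=j'$, $(i,j)\in F$, $(i',j')\notin F$; $L_v(F)$ is the number of such pairs with $i=i'$, $|j-j'|=1$, $(i,j)\in F$, $(i',j')\notin F$. The procedure. A state consists of a set $J\subseteq\{1,\ldots,n\}$ of remaining columns (initially all, with their original sums $c_j$) and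 current row sums $r_1,\ldots,r_m$ (initially the given ones). In the current state set $b_i=\#\{j\in J:c_j\ge i\}$, $d_i=b_i-r_i$ ($1\le i\le m$), $r_{m+1}=b_{m+1}=d_{m+1}=0$. If all $d_i=0$, stop. Otherwise let $i_1$ be minimal with $d_{i_1}>0$, $i_2$ minimal with $d_{i_2}>0$ and $d_{i_2+1}\le0$, $R^+=\{i_1,\ldots,i_2\}$; $i_3$ minimal with $d_{i_3}<0$, $i_4$ minimal with $d_{i_4}<0$ and $d_{i_4+1}\ge0$, $R^-=\{i_3,\ldots,i_4\}$. A-step (if $|R^+|\le|R^-|$): $j$ is the largest element of $J$ with $c_j\in R^+$, $s=c_j-i_1+1$. If $r_{i_3+s-1}>r_{i_3+s}$, $I=\{i_3,\ldots,i_3+s-1\}$; otherwise let $t_1$ be minimal with $i_3\le t_1\le i_3+s-1$ and $r_{t_1}=r_{i_3+s-1}$, $t_2\ge i_3+s$ with $r_{t_2}=r_{i_3+s-1}>r_{t_2+1}$, $t_3=t_2+t_1-i_3-s+1$, and $I=\{i_3,\ldots,t_1-1\}\cup\{t_3,\ldots,t_2\}$. Final column $j$: $\{(i,j):1\le i<i_1\}\cup\{(i,j):i\in I\}$. B-step (if $|R^+|>|R^-|$): $j$ is the smallest element of $J$ with $c_j+1\in R^-$, $s=i_4-c_j$. If $r_{i_2-s}>r_{i_2-s+1}$, $I=\{i_2-s+1,\ldots,i_2\}$; otherwise let $t_1$ be maximal with $i_2-s+1\le t_1\le i_2$ and $r_{t_1}=r_{i_2-s+1}$, $t_2\le i_2-s$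 with $r_{t_2-1}>r_{t_2}=r_{i_2-s+1}$, $t_3=t_2+s-1-(i_2-t_1)$, and $I=\{t_2,\ldots,t_3\}\cup\{t_1+1,\ldots,i_2\}$. Final column $j$: $\{(i,j):1\le i\le c_j,\ i\notin I\}\cup\{(i,j):c_j+1\le i\le i_4\}$. After each step remove $j$ from $J$ and decrease $r_i$ by $1$ for every row $i$ meeting the final column $j$, then continue. At the end, each column $j$ still in $J$ gets final content $\{(i,j):1\le i\le c_j\}$. $F_2$ is the union of the final columns; it has row sums $\mathcal{R}$ and column sums $\mathcal{C}$. *)

(* Defs.v *)
From mathcomp Require Import all_boot all_order all_algebra finmap.
From mathcomp Require Import classical_sets functions cardinality.
Set Implicit Arguments.
Unset Strict Implicit.
Unset Printing Implicit Defensive.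
Import GRing.Theory Num.Theory.
Local Open Scope ring_scope.

(* A point (i, j) of Z^2 has row i and column j (matrix convention).          *)

Definition row_sum (F : {fset int * int}) (i : int) : nat :=
  #|` [fset p in F | p.1 == i]%fset |.

Definition col_sum (F : {fset int * int}) (j : int) : nat :=
  #|` [fset p in F | p.2 == j]%fset |.

Definition h_boundary (F : {fset int * int}) :
    set ((int * int) * (int * int)) :=
  [set e | [/\ `|e.1.1 - e.2.1| = 1, e.1.2 = e.2.2,
               e.1 \in F & e.2 \notin F]]%classic.

Definition v_boundary (F : {fset int * int}) :
    set ((int * int) * (int * int)) :=
  [set e | [/\ e.1.1 = e.2.1, `|e.1.2 - e.2.2| = 1,
               e.1 \in F & e.2 \notin F]]%classic.

(* fset_set sends an infinite set to fset0; both boundaries are finite, see   *)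
(* finite_h_boundary and finite_v_boundary.                                   *)
Definition L_h (F : {fset int * int}) : nat := #|` fset_set (h_boundary F) |.
Definition L_v (F : {fset int * int}) : nat := #|` fset_set (v_boundary F) |.

Lemma norm_diff1 (x y : int) : `|x - y| = 1 -> y = x - 1 \/ y = x + 1.
Proof.
case: (ger0P (x - y)) => _ e; [left | right].
  by rewrite -e opprB addrC subrK.
by rewrite -e opprB addrC subrK.
Qed.

Lemma finite_h_boundary (F : {fset int * int}) : finite_set (h_boundary F).
Proof.
pose N := [fset (p, ((p.1 - 1)%R, p.2)) | p in F]%fset.
pose S := [fset (p, ((p.1 + 1)%R, p.2)) | p in F]%fset.
apply: (@sub_finite_set _ _ [set` (N `|` S)%fset]); last exact: finite_fset.
move=> [[i j] [i' j']] [] /= /norm_diff1 + <- pF _; rewrite in_fsetU.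
by case=> ->; apply/orP; [left | right]; apply/imfsetP; exists (i, j).
Qed.

Lemma finite_v_boundary (F : {fset int * int}) : finite_set (v_boundary F).
Proof.
pose W := [fset (p, (p.1, (p.2 - 1)%R)) | p in F]%fset.
pose E := [fset (p, (p.1, (p.2 + 1)%R)) | p in F]%fset.
apply: (@sub_finite_set _ _ [set` (W `|` E)%fset]); last exact: finite_fset.
move=> [[i j] [i' j']] [] /= <- /norm_diff1 + pF _; rewrite in_fsetU.
by case=> ->; apply/orP; [left | right]; apply/imfsetP; exists (i, j).
Qed.

(* 1-based access to (s_1, ..., s_k); the value is 0 outside {1, ..., k}.     *)
Definition ent (s : seq int) (i : nat) : int :=
  if i is k.+1 then s`_k else 0.

Definition consistent (m n : nat) (r c : seq int) : Prop :=
  exists F : {fset int * int},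
    [/\ forall p, p \in F -> (1 <= p.1 <= m%:Z) && (1 <= p.2 <= n%:Z),
        forall i : nat, (1 <= i <= m)%N -> (row_sum F i%:Z)%:Z = ent r i
      & forall j : nat, (1 <= j <= n)%N -> (col_sum F j%:Z)%:Z = ent c j].

(* #{j in J : c_j >= i}                                                       *)
Definition bsum (c : seq int) (J : seq nat) (i : nat) : nat :=
  count (fun j => i%:Z <= ent c j) J.

Definition alpha (m n : nat) (r c : seq int) : rat :=
  (\sum_(1 <= i < m.+1) `|ent r i - (bsum c (index_iota 1 n.+1) i)%:Z|)%:~R / 2.

(* Integer intervals {a, ..., b}, empty when b < a.                           *)
Definition rng (a b : nat) : seq nat := index_iota a b.+1.

(* Least and greatest element satisfying P of an increasing sequence s, with  *)
(* the dummy value 0 when there is none.                                      *)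
Definition least (s : seq nat) (P : pred nat) : nat := head 0%N (filter P s).
Definition greatest (s : seq nat) (P : pred nat) : nat := last 0%N (filter P s).

(* J is the increasing list of the remaining columns, rr the list of current  *)
(* row sums (rr_1, ..., rr_m), so that ent rr m.+1 = 0.                       *)
(* Truncated subtractions on nat are arranged so that no truncation occurs    *)
(* on the states reached by the procedure.                                    *)
Section Procedure.
Variables (m : nat) (c : seq int).

Definition dsum (J : seq nat) (rr : seq int) (i : nat) : int :=
  if (1 <= i <= m)%N then (bsum c J i)%:Z - ent rr i else 0.

(* The final column j selected in an A-step, with the rows of its points.     *)
Definition A_step (J : seq nat) (rr : seq int) (i1 i2 i3 : nat) :
    nat * seq nat :=
  let r := ent rr in
  let j := greatest J (fun j => i1%:Z <= ent c j <= i2%:Z) in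
  let s := absz (ent c j - i1%:Z + 1) in
  let I :=
    if r (i3 + s - 1)%N > r (i3 + s)%N then rng i3 (i3 + s - 1)
    else
      let t1 := least (rng i3 (i3 + s - 1)) (fun t => r t == r (i3 + s - 1)%N) in
      let t2 := least (rng (i3 + s) m)
        (fun t => (r t == r (i3 + s - 1)%N) && (r t > r t.+1)) in
      let t3 := (t2 + t1 + 1 - (i3 + s))%N in
      rng i3 (t1 - 1) ++ rng t3 t2 in
  (j, rng 1 (i1 - 1) ++ I).

(* The final column j selected in a B-step, with the rows of its points.      *)
Definition B_step (J : seq nat) (rr : seq int) (i2 i3 i4 : nat) :
    nat * seq nat :=
  let r := ent rr in
  let j := least J (fun j => i3%:Z <= ent c j + 1 <= i4%:Z) in
  let s := absz (i4%:Z - ent c j) in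
  let I :=
    if r (i2 - s)%N > r (i2 + 1 - s)%N then rng (i2 + 1 - s) i2
    else
      let t1 := greatest (rng (i2 + 1 - s) i2)
        (fun t => r t == r (i2 + 1 - s)%N) in
      let t2 := least (rng 1 (i2 - s))
        (fun t => (r t.-1 > r t) && (r t == r (i2 + 1 - s)%N)) in
      let t3 := (t2 + s - 1 - (i2 - t1))%N in
      rng t2 t3 ++ rng t1.+1 i2 in
  (j, [seq i <- rng 1 m | (i%:Z <= ent c j) && (i \notin I)]
      ++ [seq i <- rng 1 i4 | ent c j + 1 <= i%:Z]).

Definition step (J : seq nat) (rr : seq int) : nat * seq nat :=
  let d := dsum J rr in
  let i1 := least (rng 1 m) (fun i => d i > 0) in
  let i2 := least (rng 1 m) (fun i => (d i > 0) && (d i.+1 <= 0)) in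
  let i3 := least (rng 1 m) (fun i => d i < 0) in
  let i4 := least (rng 1 m) (fun i => (d i < 0) && (d i.+1 >= 0)) in
  if (size (rng i1 i2) <= size (rng i3 i4))%N
  then A_step J rr i1 i2 i3 else B_step J rr i2 i3 i4.

Definition update (rr : seq int) (col : seq nat) : seq int :=
  [seq ent rr i - (i \in col)%:R | i <- rng 1 m].

Definition remaining (J : seq nat) : seq (nat * nat) :=
  [seq (i, j) | j <- J, i <- [seq i <- rng 1 m | i%:Z <= ent c j]].

(* Each step removes one column, so k = size J steps always suffice: when the *)
(* fuel k is exhausted no column is left.                                     *)
Fixpoint run (k : nat) (J : seq nat) (rr : seq int) : seq (nat * nat) :=
  if all (fun i => dsum J rr i == 0) (rng 1 m) then remaining J
  else if k is k'.+1 then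
    let: (j, col) := step J rr in
    [seq (i, j) | i <- col] ++ run k' (rem j J) (update rr col)
  else remaining J.

End Procedure.

Definition F2 (m n : nat) (r c : seq int) : {fset int * int} :=
  [fset (p.1%:Z, p.2%:Z) | p in run m c n (rng 1 n) r]%fset.

(* Main.v *)
(* Follow the configuration X that consists of the final columns together with
   the columns {1, ..., c_j} of F_1 for the remaining j.  A step with s removed
   and s added points decreases the sum of the |d_i| by 2 s, so it suffices that
   it creates at most 2 s new horizontal and at most 2 s new vertical edges.
   For L_h: the rows of a final column form at most three intervals, and at most
   two if s = 1.  For L_v: changing a point creates at most two edges in its
   row, so it suffices that one kind of change is free.  In an A-step the
   removed points have no right neighbour, and in a B-step the added points have
   a left neighbour; by inv_pos and inv_neg below this also holds next to
   columns that are already final. *)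

Require Import Defs.
From mathcomp Require Import all_boot all_order all_algebra finmap.
From mathcomp Require Import classical_sets functions cardinality.
From mathcomp Require Import zify.
Set Implicit Arguments.
Unset Strict Implicit.
Unset Printing Implicit Defensive.
Import Order.TTheory GRing.Theory Num.Theory.
Local Open Scope ring_scope.

(** * Searching in increasing lists, counting, monotone sequences *)

Lemma mem_rng a b i : (i \in rng a b) = (a <= i <= b)%N.
Proof. by rewrite mem_index_iota ltnS. Qed.

Lemma rng_uniq a b : uniq (rng a b).
Proof. exact: iota_uniq. Qed.

Lemma size_rng a b : size (rng a b) = (b.+1 - a)%N.
Proof. exact: size_iota. Qed.

Lemma rng_sorted a b : sorted ltn (rng a b).
Proof. exact: iota_ltn_sorted. Qed.

Lemma leastP (s : seq nat) (P : pred nat) x : sorted ltn s -> x \in s -> P x ->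
  [/\ least s P \in s, P (least s P)
    & forall y, y \in s -> P y -> (least s P <= y)%N].
Proof.
move=> s_sorted xs Px; rewrite /least.
have : x \in filter P s by rewrite mem_filter Px.
have : sorted ltn (filter P s) by apply: sorted_filter => //; apply: ltn_trans.
case E: (filter P s) => [|y t] //= yt _.
have : y \in filter P s by rewrite E mem_head.
rewrite mem_filter => /andP[Py ys]; split=> // z zs Pz.
have : z \in filter P s by rewrite mem_filter Pz.
rewrite E in_cons => /orP[/eqP->//|zt].
by have /allP/(_ z zt)/ltnW := order_path_min ltn_trans yt.
Qed.

Lemma greatestP (s : seq nat) (P : pred nat) x :
  sorted ltn s -> x \in s -> P x ->
  [/\ greatest s P \in s, P (greatest s P)
    & forall y, y \in s -> P y -> (y <= greatest s P)%N].
Proof.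
move=> s_sorted xs Px; rewrite /greatest.
have : x \in filter P s by rewrite mem_filter Px.
have : sorted ltn (filter P s) by apply: sorted_filter => //; apply: ltn_trans.
case/lastP E: (filter P s) => [|t y] //= ty _; rewrite last_rcons.
have : y \in filter P s by rewrite E mem_rcons mem_head.
rewrite mem_filter => /andP[Py ys]; split=> // z zs Pz.
have : z \in filter P s by rewrite mem_filter Pz.
rewrite E mem_rcons in_cons => /orP[/eqP->//|zt].
move: ty; rewrite (sorted_pairwise ltn_trans) pairwise_rcons => /andP[+ _].
by move=> /allP/(_ z zt)/ltnW.
Qed.

Lemma sum_mem (s : seq nat) a b : uniq s ->
  {in s, forall i, (a <= i < b)%N} -> (\sum_(a <= i < b) (i \in s) = size s)%N.
Proof.
move=> s_uniq sab; rewrite -big_mkcond /= sum1_count -size_filter.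
apply/perm_size/uniq_perm => // [|i]; first by rewrite filter_uniq ?iota_uniq.
by rewrite mem_filter mem_index_iota; case: (boolP (i \in s)) => // /sab ->.
Qed.

Lemma noninc_le (f : nat -> int) a b :
  (forall i, (a <= i < b)%N -> f i.+1 <= f i) ->
  forall i j, (a <= i)%N -> (i <= j)%N -> (j <= b)%N -> f j <= f i.
Proof.
move=> fS i j ai; elim: j => [|j IH] ij jb; first by have -> : i = 0%N by lia.
case: (eqVneq i j.+1) => [->//|ne].
have := IH ltac:(lia) ltac:(lia); have := fS j ltac:(lia); lia.
Qed.

(** * Boundary edges along one line of cells *)

(** The cells are [1..k]; starting at 0 and ending with the pair [k, k.+1] includes both ends of the
    line. *)
Definition edges (k : nat) (x : pred nat) : nat :=
  \sum_(0 <= i < k.+1) (x i != x i.+1).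

Lemma edges_le k x (s : seq nat) :
  (forall i, (i <= k)%N -> x i != x i.+1 -> i \in s) -> (edges k x <= size s)%N.
Proof.
move=> xs; rewrite /edges -big_mkcond /= sum1_count -size_filter.
apply: uniq_leq_size => [|i]; first by rewrite filter_uniq ?iota_uniq.
by rewrite mem_filter mem_index_iota => /andP[/xs H] /andP[_ /H].
Qed.

Lemma eq_edges k x y : x =1 y -> edges k x = edges k y.
Proof. by move=> xy; apply: eq_bigr => i _; rewrite !xy. Qed.

Lemma sum_pred1 k j : (j <= k)%N -> (\sum_(0 <= i < k.+1) (i == j) = 1)%N.
Proof.
move=> jk; rewrite -[RHS](@sum_mem [:: j] 0 k.+1) // => [|i].
  by apply: eq_bigr => i _; rewrite inE.
by rewrite inE => /eqP->; lia.
Qed.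

Section Flip.
Variables (k j : nat) (x y : pred nat).
Hypothesis j_range : (0 < j <= k)%N.
Hypothesis xy : forall q, q != j -> x q = y q.

Lemma edges_flip : (edges k x <= edges k y + 2)%N.
Proof.
have <- : (\sum_(0 <= i < k.+1) ((i == j.-1) + (i == j)) = 2)%N.
  by rewrite big_split /= !sum_pred1; lia.
rewrite /edges -big_split /=; apply: leq_sum => i _.
have := @xy i; have := @xy i.+1.
case: (x i) (y i) (x i.+1) (y i.+1) => [] [] [] []; lia.
Qed.

(** The change at [j] disappears and pays for the one that may appear at [j.-1]; the two indicator
    sums book this transfer. *)
Lemma edges_flip_right :
  ~~ x j -> y j -> ~~ y j.+1 -> (edges k x <= edges k y)%N.
Proof.
move=> xj yj yj1; rewrite -(leq_add2r 1).
rewrite -{1}(@sum_pred1 k j) -?(@sum_pred1 k j.-1); try lia.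
rewrite /edges -!big_split /=; apply: leq_sum => i _.
have := @xy i; have := @xy i.+1.
case: (eqVneq i j) => [->|].
  by move: xj yj yj1; case: (x j) (y j) (x j.+1) (y j.+1) => [] [] [] []; lia.
case: (x i) (y i) (x i.+1) (y i.+1) => [] [] [] []; lia.
Qed.

Lemma edges_flip_left :
  x j -> ~~ y j -> y j.-1 -> (edges k x <= edges k y)%N.
Proof.
move=> xj yj yj1; rewrite -(leq_add2r 1).
rewrite -{1}(@sum_pred1 k j.-1) -?(@sum_pred1 k j); try lia.
rewrite /edges -!big_split /=; apply: leq_sum => i _.
have := @xy i; have := @xy i.+1.
case: (eqVneq i j.-1) => [->|].
  move: xj yj yj1; rewrite prednK; last by lia.
  by case: (x j.-1) (y j.-1) (x j) (y j) => [] [] [] []; lia.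
case: (x i) (y i) (x i.+1) (y i.+1) => [] [] [] []; lia.
Qed.

End Flip.

(** * The row sets of a step *)

(** [q] marks the ends of the blocks of [p]. A gap of [p] between its first element and the first
    end would produce an earlier end. *)
Lemma block_bounds m (p q : pred nat) x : (1 <= x <= m)%N -> p x -> ~~ p m.+1 ->
  (forall i, q i = p i && ~~ p i.+1) ->
  let a := least (rng 1 m) p in let b := least (rng 1 m) q in
  [/\ (1 <= a <= b)%N, (b <= m)%N, forall i, (a <= i <= b)%N -> p i, ~~ p b.+1
    & forall i, (1 <= i < a)%N -> ~~ p i].
Proof.
rewrite -mem_rng => xm px pm qE a b.
have [] := leastP (rng_sorted 1 m) xm px; rewrite -/a mem_rng => am pa a_min.
have [/hasP[y ym qy]|/hasPn noq] := boolP (has q (rng 1 m)).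
  have [] := leastP (rng_sorted 1 m) ym qy; rewrite -/b mem_rng qE.
  move=> bm /andP[pb pb1] b_min.
  have ab : (a <= b)%N by apply: a_min; rewrite ?mem_rng.
  have p_ab i : (a <= i <= b)%N -> p i.
    elim: i => [|i IH] iab; first lia.
    have [-> //|ne] := eqVneq i.+1 a; apply: contraT => pi1.
    have pi : p i by apply: IH; clear -iab ne; lia.
    have := b_min i; rewrite mem_rng qE pi pi1 => /(_ _ isT).
    by clear -iab am bm ne; lia.
  have p_a i : (1 <= i < a)%N -> ~~ p i.
    move=> ia; apply/negP => pi; have := a_min i; rewrite mem_rng pi.
    by clear -am ia; lia.
  by split=> //; clear -am ab bm; lia.
suff p_am i : (a <= i <= m.+1)%N -> p i by rewrite p_am in pm => //; lia.
elim: i => [|i IH] ia; first lia.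
have [-> //|ne] := eqVneq i.+1 a; apply: contraT => pi1.
have := noq i; rewrite mem_rng qE pi1 IH /=; lia.
Qed.

Section Rows.
Variables (f : nat -> int) (m s : nat).
Hypothesis fS : forall i, (0 < i)%N -> f i.+1 <= f i.
Hypothesis s_gt0 : (0 < s)%N.

Let f_le i k : (0 < i)%N -> (i <= k)%N -> f k <= f i.
Proof.
by move=> i_gt0 ik; apply: (@noninc_le f 1 k) => // q ?; apply: fS; lia.
Qed.

(* Subtracting 1 on I keeps f nonincreasing because f drops after the last row
   of each of the two intervals of I. *)
Lemma A_rows a : (0 < a)%N -> (a + s <= m.+1)%N -> f m.+1 = 0 ->
  0 < f (a + s - 1)%N ->
  let I := if f (a + s - 1)%N > f (a + s)%N then rng a (a + s - 1)
    else
      let t1 := least (rng a (a + s - 1)) (fun t => f t == f (a + s - 1)%N) in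
      let t2 := least (rng (a + s) m)
        (fun t => (f t == f (a + s - 1)%N) && (f t > f t.+1)) in
      let t3 := (t2 + t1 + 1 - (a + s))%N in
      rng a (t1 - 1) ++ rng t3 t2 in
  uniq I /\ size I = s /\ exists u v e,
  [/\ forall i, (i \in I) = (a <= i < u)%N || (v <= i <= e)%N,
      [/\ (a <= u)%N, (u <= v)%N, (v <= e)%N, (e <= m)%N & (a + s <= e.+1)%N],
      (a < u)%N -> (1 < s)%N /\ f u < f u.-1,
      f e.+1 < f e
    & forall i, (a + s - 1 <= i <= e)%N -> f i = f (a + s - 1)%N].
Proof.
move=> a_gt0 asm fm f_gt0 I; rewrite /I {I}.
set z := (a + s - 1)%N; have zE : (a + s)%N = z.+1 by rewrite /z; lia.
rewrite {}zE in asm *; have az : (a <= z)%N by rewrite /z; lia.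
have sE : s = (z.+1 - a)%N by rewrite /z; lia.
rewrite -/z in f_gt0; move: z {f_gt0} asm az sE (f_gt0) => z asm az sE f_gt0.
case: ifP => [lt|/negbT]; last rewrite -leNgt => ge.
  rewrite rng_uniq size_rng; split=> //; split=> //.
  exists a, a, z; split=> //; try lia.
  - by move=> i; rewrite mem_rng; lia.
  - by move=> i iz; have -> : i = z by lia.
have zz : z \in rng a z by rewrite mem_rng; lia.
have [] := @leastP _ (fun t => f t == f z) _ (rng_sorted a z) zz (eqxx _).
set t1 := least _ _; rewrite mem_rng => t1z /eqP ft1 t1_min.
set q := fun t => _ && _.
have [/hasP[y ym qy]|/hasPn noq] := boolP (has q (rng z.+1 m)); last first.
  (* If the level of [z] never ended in a drop, it would extend to [m.+1], where [f] is 0, against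
     [0 < f z]. *)
  suff fz i : (z <= i <= m.+1)%N -> f i = f z by have := fz m.+1; lia.
  elim: i => [|i IH] iz; first lia.
  have [->//|ne] := eqVneq i.+1 z.
  have [iz'|iz'] := eqVneq i z; first by have := fS (i := z); rewrite iz'; lia.
  have := noq i; rewrite mem_rng /q; have := fS (i := i); rewrite IH; lia.
have [] := leastP (rng_sorted z.+1 m) ym qy.
set t2 := least _ _; rewrite mem_rng => t2m /andP[/eqP ft2 ft2'] _.
have e_t3 i : (i \in rng a (t1 - 1) ++ rng (t2 + t1 + 1 - z.+1) t2) =
    (a <= i < t1)%N || (t2 + t1 + 1 - z.+1 <= i <= t2)%N.
  by rewrite mem_cat !mem_rng; lia.
split.
  rewrite cat_uniq !rng_uniq andbT; apply/hasPn => i; rewrite !mem_rng; lia.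
(* [t3] makes [t3..t2] as long as [t1..z], the part of the plain interval that it replaces. *)
split; first by rewrite size_cat !size_rng; lia.
exists t1, (t2 + t1 + 1 - z.+1)%N, t2; split=> //; try by split; lia.
- move=> at1; split; first lia.
  have := t1_min t1.-1; rewrite mem_rng; have := @f_le t1.-1 t1; lia.
- move=> i iz; have := @f_le z i; have := @f_le i t2; lia.
Qed.

(* Subtracting 1 outside I keeps f nonincreasing because f drops before the
   first row of each of the two intervals of I. *)
Lemma B_rows b : (s < b)%N -> f 0%N <= f 1%N -> f (b + 1 - s)%N < f 1%N ->
  let I := if f (b - s)%N > f (b + 1 - s)%N then rng (b + 1 - s) b
    else
      let t1 := greatest (rng (b + 1 - s) b)
        (fun t => f t == f (b + 1 - s)%N) in
      let t2 := least (rng 1 (b - s))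
        (fun t => (f t.-1 > f t) && (f t == f (b + 1 - s)%N)) in
      let t3 := (t2 + s - 1 - (b - t1))%N in
      rng t2 t3 ++ rng t1.+1 b in
  uniq I /\ size I = s /\ exists v w u,
  [/\ forall i, (i \in I) = (v <= i <= w)%N || (u < i <= b)%N,
      [/\ (1 < v)%N, (v <= w)%N, (w <= u)%N, (u <= b)%N & (v <= b + 1 - s)%N],
      (u < b)%N -> (1 < s)%N /\ f u.+1 < f u,
      f v < f v.-1
    & forall i, (v <= i <= b + 1 - s)%N -> f i = f (b + 1 - s)%N].
Proof.
move=> sb f0 f1 I; rewrite /I {I}.
set z := (b + 1 - s)%N; have zE : (b - s)%N = z.-1 by rewrite /z; lia.
rewrite {}zE; have z_gt1 : (1 < z)%N by rewrite /z; lia.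
have sE : s = (b.+1 - z)%N by rewrite /z; lia.
have zb : (z <= b)%N by rewrite /z; lia.
rewrite -/z in f1; move: z {f1} z_gt1 sE zb (f1) => z z_gt1 sE zb f1.
case: ifP => [lt|/negbT]; last rewrite -leNgt => ge.
  rewrite rng_uniq size_rng; split=> //; split=> //.
  exists z, b, b; split=> //; try lia; try by split; lia.
  - by move=> i; rewrite mem_rng; lia.
  - by move=> i iz; have -> : i = z by lia.
have zz : z \in rng z b by rewrite mem_rng; lia.
have [] := @greatestP _ (fun t => f t == f z) _ (rng_sorted z b) zz (eqxx _).
set t1 := greatest _ _; rewrite mem_rng => t1z /eqP ft1 t1_max.
have z1 : z.-1 \in rng 1 z.-1 by rewrite mem_rng; lia.
have fz1 : f z.-1 == f z by have := @fS z.-1; rewrite prednK; lia.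
have [] := @leastP _ (fun t => f t == f z) _ (rng_sorted 1 z.-1) z1 fz1.
set t0 := least _ _; rewrite mem_rng => t0z /eqP ft0 t0_min.
(* [t0] is the first row on the level of [z]. It is not row 1 because [f z < f 1], so a drop
   precedes it and the search for [t2] succeeds. *)
have t0_gt1 : (1 < t0)%N.
  by case: (eqVneq t0 1%N) => [e|]; [rewrite e in ft0|]; lia.
set q := fun t => _ && _.
have qt0 : q t0.
  rewrite /q ft0 eqxx andbT; have := t0_min t0.-1; rewrite mem_rng.
  have := @f_le t0.-1 t0; lia.
have t0m : t0 \in rng 1 z.-1 by rewrite mem_rng.
have [] := leastP (rng_sorted 1 z.-1) t0m qt0.
set t2 := least _ _; rewrite mem_rng => t2z /andP[ft2' /eqP ft2] _.
(* The dummy row 0 creates no drop before row 1, by [f 0 <= f 1]. *)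
have t2_gt1 : (1 < t2)%N.
  by case: (eqVneq t2 1%N) => [e|]; [rewrite e /= in ft2'|]; lia.
split.
  rewrite cat_uniq !rng_uniq andbT; apply/hasPn => i; rewrite !mem_rng; lia.
split; first by rewrite size_cat !size_rng; lia.
exists t2, (t2 + s - 1 - (b - t1))%N, t1; split=> //; try by split; lia.
- by move=> i; rewrite mem_cat !mem_rng.
- move=> at1; split; first lia.
  have := t1_max t1.+1; rewrite mem_rng; have := @fS t1; lia.
- move=> i iz; have := @f_le i z; have := @f_le t2 i; lia.
Qed.

End Rows.

(** * The invariants and the effect of a step *)

Lemma sum_mem_int (s : seq nat) (k : nat) : uniq s ->
  {in s, forall i, (1 <= i <= k)%N} ->
  \sum_(1 <= i < k.+1) (i \in s)%:R = (size s)%:R :> int.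
Proof. by move=> s_uniq sk; rewrite -natr_sum sum_mem. Qed.

Section PrefixSums.
Variables (m i0 e : nat) (d d' : nat -> int) (P Q : seq nat).
Hypothesis P_uniq : uniq P.
Hypothesis Q_uniq : uniq Q.
Hypothesis sizePQ : size P = size Q.
Hypothesis P_range : {in P, forall i, (1 <= i <= e)%N}.
Hypothesis Q_range : {in Q, forall i, (1 <= i <= e)%N}.
Hypothesis d'E : forall i, d' i = d i - (i \in P)%:R + (i \in Q)%:R.

Lemma prefix_sum_after k : (e <= k)%N ->
  \sum_(1 <= i < k.+1) d' i = \sum_(1 <= i < k.+1) d i.
Proof.
move=> ek; under eq_bigr do rewrite d'E; rewrite !big_split /= sumrN.
rewrite (sum_mem_int P_uniq) ?(sum_mem_int Q_uniq) ?sizePQ ?subrK // => i.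
  by move=> /Q_range; lia.
by move=> /P_range; lia.
Qed.

Hypothesis e_le : (e <= m)%N.

(** Before [i0] all terms are nonnegative. Between [i0] and [e] they are nonpositive, so a prefix
    sum there is at least the one at [e], which is unchanged because [P] and [Q] have equal size. *)
Lemma prefix_sum_ge0 :
  (forall i, (i < i0)%N -> 0 <= d' i) ->
  (forall i, (i0 <= i <= e)%N -> d' i <= 0) ->
  (forall k, (k <= m)%N -> 0 <= \sum_(1 <= i < k.+1) d i) ->
  forall k, (k <= m)%N -> 0 <= \sum_(1 <= i < k.+1) d' i.
Proof.
move=> d'_ge0 d'_le0 sum_ge0 k km.
have [ek|ke] := leqP e k; first by rewrite prefix_sum_after // sum_ge0.
have [ki|ik] := ltnP k i0.
  by rewrite big_nat; apply: sumr_ge0 => i ik; apply: d'_ge0; lia.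
have := sum_ge0 e e_le; rewrite -prefix_sum_after //.
rewrite (@big_cat_nat _ _ _ k.+1) //=; last lia.
suff sum_le0 : \sum_(k.+1 <= i < e.+1) d' i <= 0.
  by move=> sum_ek; apply: le_trans sum_ek _; rewrite gerDl.
by rewrite big_nat; apply: sumr_le0 => i ike; apply: d'_le0; lia.
Qed.

End PrefixSums.

Section Potential.
Variables (m n : nat) (c : seq int).

Definition cn j : nat := absz (ent c j).

Definition recol (X : nat -> pred nat) (j : nat) (col : seq nat) i q :=
  if q == j then i \in col else X i q.

(** [inv_prefix] and [inv_total] are the Gale-Ryser dominance conditions for the remaining columns;
    they force the first nonzero block of [d] to be positive. [inv_d1] keeps row 1 out of all
    changes. *)
Record state_inv (J : seq nat) (rr : seq int) (X : nat -> pred nat) : Prop := {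
  inv_sorted : sorted ltn J;
  inv_range : {in J, forall j, (1 <= j <= n)%N};
  inv_size : size rr = m;
  inv_mono : forall i, (0 < i)%N -> ent rr i.+1 <= ent rr i;
  inv_d1 : dsum m c J rr 1 = 0;
  inv_prefix : forall k, (k <= m)%N ->
    0 <= \sum_(1 <= i < k.+1) dsum m c J rr i;
  inv_total : \sum_(1 <= i < m.+1) dsum m c J rr i = 0;
  inv_unused : forall i j, j \in J -> X i j = (1 <= i <= cn j)%N;
  inv_support : forall i j, X i j -> (1 <= i <= m)%N && (1 <= j <= n)%N;
  (* Columns q that became final in an A-step satisfy this vacuously; for a
     B-step with last added row i4 the witness is e = i4, as c_p >= i4.  Inside
     a block of positive d there is no such e, hence X i q fails there. *)
  inv_pos : forall i p q, p \in J -> (p < q <= n)%N -> q \notin J ->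
    0 < dsum m c J rr i -> (i <= cn p)%N -> X i q ->
    exists2 e, (i < e <= cn p)%N & dsum m c J rr e <= 0;
  (* Here the witness is i1 for an A-step and i4 + 1 for a B-step. *)
  inv_neg : forall i p q, p \in J -> (1 <= q < p)%N -> q \notin J ->
    dsum m c J rr i < 0 -> (cn p < i)%N -> ~~ X i q ->
    exists2 e, (cn p < e < i)%N & 0 <= dsum m c J rr e }.

(* P and Q are the rows of the points removed from and added to column j. *)
Record step_spec (J : seq nat) (rr : seq int) (X : nat -> pred nat)
    (j : nat) (col P Q : seq nat) : Prop := {
  step_mem : j \in J;
  step_removed : forall i, i \in P -> (1 <= i <= cn j)%N /\ 0 < dsum m c J rr i;
  step_added : forall i, i \in Q -> (cn j < i <= m)%N /\ dsum m c J rr i < 0;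
  step_uniq_removed : uniq P;
  step_uniq_added : uniq Q;
  step_size : size P = size Q;
  step_col : forall i,
    (i \in col) = (1 <= i <= cn j)%N && (i \notin P) || (i \in Q);
  step_mono : forall i, (0 < i)%N ->
    ent rr i.+1 - (i.+1 \in col)%:R <= ent rr i - (i \in col)%:R;
  step_edges : (edges m (mem col) <= 2 + 2 * size P)%N;
  step_block : exists i0 e, [/\ (e <= m)%N,
    {in P, forall i, (i <= e)%N}, {in Q, forall i, (i <= e)%N},
    forall i, (i < i0)%N -> 0 <= dsum m c J rr i
  & forall i, (i0 <= i <= e)%N -> dsum m c J rr i < 0];
  step_neighbour :
    {in P, forall i, ~~ X i j.+1} \/ {in Q, forall i, X i j.-1};
  step_pos : forall i p, p \in J -> (p < j)%N -> 0 < dsum m c J rr i ->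
    (i <= cn p)%N -> i \in col ->
    exists2 e, (i < e <= cn p)%N & dsum m c J rr e <= 0;
  step_neg : forall i p, p \in J -> (j < p)%N -> dsum m c J rr i < 0 ->
    (cn p < i)%N -> i \notin col ->
    exists2 e, (cn p < e < i)%N & 0 <= dsum m c J rr e }.

Lemma bsumS J i : (bsum c J i.+1 <= bsum c J i)%N.
Proof. by apply: sub_count => j /=; lia. Qed.

Lemma bsum_le J i k : (i <= k)%N -> (bsum c J k <= bsum c J i)%N.
Proof. by move=> ik; apply: sub_count => j /=; lia. Qed.

(** The drop counts the remaining columns of length exactly [i]; this shows that a step has a column
    to select. *)
Lemma bsum_drop J i : (bsum c J i.+1 < bsum c J i)%N ->
  exists2 j, j \in J & ent c j = i%:Z.
Proof.
move=> lt; suff /hasP[j jJ /eqP] : has (fun j => ent c j == i%:Z) J by exists j.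
apply: contraTT lt => /hasPn nJ; rewrite -leqNgt.
by apply/eq_leq/eq_in_count => j /nJ; lia.
Qed.

Lemma bsum_rem J j i : j \in J ->
  bsum c J i = ((i%:Z <= ent c j)%R + bsum c (rem j J) i)%N.
Proof. by rewrite /bsum => /perm_to_rem/permP->. Qed.

Lemma ent_update rr (col : seq nat) i : size rr = m ->
  {in col, forall i, (1 <= i <= m)%N} ->
  ent (update m rr col) i = ent rr i - (i \in col)%:R.
Proof.
move=> rr_size colm; case: i => [|i] /=.
  by case: (boolP (0%N \in col)) => // /colm.
have [im|mi] := ltnP i m.
  by rewrite /update (nth_map 0%N) ?size_rng ?nth_iota // subn1.
rewrite !nth_default ?rr_size ?size_map ?size_rng ?subn1 //.
by case: (boolP (i.+1 \in col)) => // /colm; lia.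
Qed.

(** Equal to [2 * alpha] at the start; the budget from which new edges are paid. *)
Definition discrepancy J rr : nat :=
  \sum_(1 <= i < m.+1) `|dsum m c J rr i|%N.

Definition row_edges (X : nat -> pred nat) : nat :=
  \sum_(1 <= i < m.+1) edges n (X i).

(* A remaining column {1, ..., c_j} counts as 2; J = [::] gives L_h. *)
Definition col_edges (J : seq nat) (X : nat -> pred nat) : nat :=
  \sum_(1 <= j < n.+1) (if j \in J then 2%N else edges m (X^~ j)).

Hypothesis c_range : forall j, (1 <= j <= n)%N -> 0 <= ent c j <= m%:Z.

Lemma cnE j : (1 <= j <= n)%N -> ent c j = (cn j)%:Z.
Proof. by move=> /c_range; rewrite /cn; lia. Qed.

Lemma cn_le j : (1 <= j <= n)%N -> (cn j <= m)%N.
Proof. by move=> /c_range; rewrite /cn; lia. Qed.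

Section Step.
Variables (J : seq nat) (rr : seq int) (X : nat -> pred nat).
Variables (j : nat) (col P Q : seq nat).
Hypothesis inv : state_inv J rr X.
Hypothesis spec : step_spec J rr X j col P Q.

Let d := dsum m c J rr.
Let J' := rem j J.
Let rr' := update m rr col.
Let X' := recol X j col.
Let d' := dsum m c J' rr'.

Let j_range : (1 <= j <= n)%N.
Proof. exact: (inv_range inv) (step_mem spec). Qed.

Lemma col_range : {in col, forall i, (1 <= i <= m)%N}.
Proof.
move=> i; rewrite (step_col spec); have := cn_le j_range.
by case: (boolP (i \in Q)) => [/(step_added spec)[]|] *; lia.
Qed.

(** Removing [j] lowers [b_i] for [i <= cn j] and [r_i] for [i] in [col]; these cancel except on [P]
    and [Q]. *)
Lemma dsum_step i : d' i = d i - (i \in P)%:R + (i \in Q)%:R.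
Proof.
have := @step_removed _ _ _ _ _ _ _ spec i.
have := @step_added _ _ _ _ _ _ _ spec i.
rewrite /d' /d /dsum /J'.
have := cn_le j_range.
case: ifP => [im|] jm; last by case: (i \in P) (i \in Q) => [] []; lia.
rewrite (ent_update _ (inv_size inv) col_range) (step_col spec).
rewrite (bsum_rem _ (step_mem spec)) (cnE j_range).
case: (i \in P) (i \in Q) => [] []; lia.
Qed.

(** [d] is a positive integer on [P] and a negative one on [Q], so a move by one toward 0 never
    crosses it. *)
Lemma sign_step i : [/\ 0 < d' i -> 0 < d i, d' i < 0 -> d i < 0,
  0 <= d i -> 0 <= d' i & d i <= 0 -> d' i <= 0].
Proof.
have := @step_removed _ _ _ _ _ _ _ spec i.
have := @step_added _ _ _ _ _ _ _ spec i.
rewrite dsum_step -/d.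
by case: (i \in P) (i \in Q) => [] [] Qi Pi; split; lia.
Qed.

Lemma mem_rest q : (q \in J') = (q != j) && (q \in J).
Proof.
by rewrite mem_rem_uniq ?(sorted_uniq ltn_trans ltnn) ?(inv_sorted inv) // inE.
Qed.

Lemma inv_step : state_inv J' rr' X'.
Proof.
have [i0 [e [em Pe Qe d_ge0 d_lt0]]] := step_block spec.
have Pe1 : {in P, forall i, (1 <= i <= e)%N}.
  by move=> i iP; have := Pe _ iP; have [] := step_removed spec iP; lia.
have Qe1 : {in Q, forall i, (1 <= i <= e)%N}.
  by move=> i iQ; have := Qe _ iQ; have [] := step_added spec iQ; lia.
have [P_uniq Q_uniq] := (step_uniq_removed spec, step_uniq_added spec).
split.
- exact: (subseq_sorted ltn_trans (rem_subseq _ _) (inv_sorted inv)).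
- by move=> q; rewrite mem_rest => /andP[_ /(inv_range inv)].
- by rewrite size_map size_rng subn1.
- move=> i i_gt0; rewrite !(ent_update _ (inv_size inv) col_range).
  exact: (step_mono spec).
- have := inv_d1 inv; rewrite -/d => d1.
  by have [] := sign_step 1; rewrite -/d' d1; lia.
- apply: (prefix_sum_ge0 P_uniq Q_uniq (step_size spec) Pe1 Qe1 dsum_step em).
  + by move=> i /d_ge0; have [] := sign_step i.
  + by move=> i /d_lt0; have [] := sign_step i; rewrite /d; lia.
  + exact: inv_prefix inv.
- rewrite -[RHS](inv_total inv).
  exact: (prefix_sum_after P_uniq Q_uniq (step_size spec) Pe1 Qe1 dsum_step em).
- by move=> i q; rewrite mem_rest /X' /recol => /andP[/negPf-> /(inv_unused inv)].
- move=> i q; rewrite /X' /recol; case: eqP => [-> /col_range->//|_].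
  exact: (inv_support inv).
(* For a column that was final before, the old witness survives by [sign_step]; for [j] itself it
   comes from [step_pos]. *)
- move=> i p q; rewrite !mem_rest negb_and negbK /X' /recol => /andP[pj pJ] pq.
  move=> qJ /(let: And4 h _ _ _ := sign_step i in h) di ip.
  suff : (if q == j then i \in col else X i q) ->
      exists2 e, (i < e <= cn p)%N & d e <= 0.
    move=> H /H[e' ie' de']; exists e' => //.
    exact: (let: And4 _ _ _ h := sign_step e' in h).
  move: qJ pq; case: eqP => [-> _ /andP[pj' _]|_ /= qJ pq].
    exact: (step_pos spec pJ pj' di ip).
  exact: (inv_pos inv pJ pq qJ di ip).
- move=> i p q; rewrite !mem_rest negb_and negbK /X' /recol => /andP[pj pJ] pq.
  move=> qJ /(let: And4 _ h _ _ := sign_step i in h) di ip.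
  suff : ~~ (if q == j then i \in col else X i q) ->
      exists2 e, (cn p < e < i)%N & 0 <= d e.
    move=> H /H[e' ie' de']; exists e' => //.
    exact: (let: And4 _ _ h _ := sign_step e' in h).
  move: qJ pq; case: eqP => [-> _ /andP[_ jp]|_ /= qJ pq].
    exact: (step_neg spec pJ jp di ip).
  exact: (inv_neg inv pJ pq qJ di ip).
Qed.

Let P_range : {in P, forall i, (1 <= i < m.+1)%N}.
Proof. by move=> i /(step_removed spec)[]; have := cn_le j_range; lia. Qed.

Let Q_range : {in Q, forall i, (1 <= i < m.+1)%N}.
Proof. by move=> i /(step_added spec)[]; lia. Qed.

Lemma discrepancy_step :
  (discrepancy J' rr' + 2 * size P = discrepancy J rr)%N.
Proof.
rewrite mul2n -addnn {2}(step_size spec).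
rewrite -(sum_mem (step_uniq_removed spec) P_range).
rewrite -(sum_mem (step_uniq_added spec) Q_range) /discrepancy -!big_split /=.
apply: eq_bigr => i _; rewrite -/d' dsum_step -/d.
have := @step_removed _ _ _ _ _ _ _ spec i.
have := @step_added _ _ _ _ _ _ _ spec i.
rewrite -/d; case: (i \in P) (i \in Q) => [] []; lia.
Qed.

(** Column [j], counted as 2 so far, gets at most [2 + 2 * size P] edges; the other columns are
    untouched. *)
Lemma col_edges_step : (col_edges J' X' <= col_edges J X + 2 * size P)%N.
Proof.
have j1 : (\sum_(1 <= q < n.+1) (q \in [:: j]) = 1)%N.
  by apply: sum_mem => // q; rewrite inE => /eqP->; rewrite ltnS.
rewrite -[X in (_ + X)%N]muln1 -[X in (_ * X)%N]j1 big_distrr -big_split /=.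
apply: leq_sum => q _; rewrite mem_rest /X' /recol inE.
case: eqP => [->|_] /=; last by rewrite muln0 addn0.
rewrite muln1 (step_mem spec) (@eq_edges _ _ (mem col)) //.
exact: step_edges spec.
Qed.

Lemma row_edges_step : (row_edges X' <= row_edges X + 2 * size P)%N.
Proof.
have Xj i : X i j = (1 <= i <= cn j)%N := inv_unused inv i (step_mem spec).
have XX' i q : q != j -> X' i q = X i q by rewrite /X' /recol => /negPf->.
have X'j i : X' i j = (i \in col) by rewrite /X' /recol eqxx.
(* [S] consists of the rows charged with two new edges: those of [Q] if removals are free, those of
   [P] if additions are free. *)
have bound (S : seq nat) : uniq S -> {in S, forall i, (1 <= i < m.+1)%N} ->
    (forall i, i \notin S -> (edges n (X' i) <= edges n (X i))%N) ->
    (row_edges X' <= row_edges X + 2 * size S)%N.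
  move=> S_uniq S_range S_edges; rewrite -(sum_mem S_uniq S_range) big_distrr.
  rewrite -big_split /=; apply: leq_sum => i _.
  have := S_edges i; have := edges_flip j_range (XX' i).
  by case: (i \in S) => /=; [lia|rewrite muln0 addn0 => _; apply].
have same i : i \notin P -> i \notin Q -> (edges n (X' i) <= edges n (X i))%N.
  move=> iP iQ; apply/eq_leq/eq_edges => q; have [->|/XX'->//] := eqVneq q j.
  by rewrite X'j Xj (step_col spec) iP (negPf iQ) andbT orbF.
case: (step_neighbour spec) => [Pn|Qn].
- rewrite (step_size spec); apply: bound => // [|i iQ].
    exact: (step_uniq_added spec).
  case: (boolP (i \in P)) => iP; last exact: same.
  apply: (edges_flip_right j_range (XX' i)).
  + by rewrite X'j (step_col spec) iP andbF.
  + by rewrite Xj; have [] := step_removed spec iP.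
  + exact: Pn.
- apply: bound => // [|i iP]; first exact: (step_uniq_removed spec).
  case: (boolP (i \in Q)) => iQ; last exact: same.
  apply: (edges_flip_left j_range (XX' i)).
  + by rewrite X'j (step_col spec) iQ orbT.
  + by rewrite Xj; have [] := step_added spec iQ; lia.
  + exact: Qn.
Qed.

End Step.

End Potential.

(** * A-steps and B-steps *)

Section Steps.
Variables (m n : nat) (c : seq int).
Hypothesis c_range : forall j, (1 <= j <= n)%N -> 0 <= ent c j <= m%:Z.
Hypothesis c_mono : forall j k, (1 <= j)%N -> (j <= k)%N -> (k <= n)%N ->
  ent c k <= ent c j.

Lemma cn_mono j k : (1 <= j)%N -> (j <= k)%N -> (k <= n)%N ->
  (cn c k <= cn c j)%N.
Proof.
move=> j1 jk kn; have := c_mono j1 jk kn.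
by rewrite !(cnE c_range) //; lia.
Qed.

Hypothesis c_1 : ent c 1 = m%:Z.

Section State.
Variables (J : seq nat) (rr : seq int) (X : nat -> pred nat).
Hypothesis inv : state_inv m n c J rr X.

Let d := dsum m c J rr.

Lemma dE i : (1 <= i <= m)%N -> d i = (bsum c J i)%:Z - ent rr i.
Proof. by rewrite /d /dsum => ->. Qed.

Lemma d_out i : ~~ (1 <= i <= m)%N -> d i = 0.
Proof. by rewrite /d /dsum => /negPf->. Qed.

Lemma rr_last : ent rr m.+1 = 0.
Proof. by rewrite /= nth_default ?(inv_size inv). Qed.

Lemma rr_ge0 i : (1 <= i <= m.+1)%N -> 0 <= ent rr i.
Proof.
move=> im; rewrite -rr_last; apply: (@noninc_le (ent rr) 1 m.+1); try lia.
by move=> k km; apply: (inv_mono inv); lia.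
Qed.

(** Where the row sums are constant, [d] follows [b]. This carries the sign of [d] from the plain
    interval to the shifted part of [I]. *)
Lemma d_le_flat i k : (1 <= i)%N -> (i <= k)%N -> (k <= m)%N ->
  ent rr k = ent rr i -> d k <= d i.
Proof.
move=> i1 ik km e; rewrite !dE ?e; try lia.
have := bsum_le c J ik; lia.
Qed.

Lemma A_step_spec i1 i2 i3 i4 :
  (1 <= i1 <= i2)%N -> (i2 < i3 <= i4)%N -> (i4 <= m)%N ->
  (i2 - i1 <= i4 - i3)%N ->
  (forall i, (i1 <= i <= i2)%N -> 0 < d i) -> d i2.+1 <= 0 ->
  (forall i, (i < i1)%N -> d i = 0) -> (forall i, (i < i3)%N -> 0 <= d i) ->
  (forall i, (i3 <= i <= i4)%N -> d i < 0) ->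
  exists P Q, step_spec m c J rr X (A_step m c J rr i1 i2 i3).1
    (A_step m c J rr i1 i2 i3).2 P Q.
Proof.
move=> i12 i34 i4m size_le d_pos d_i2 d_zero d_ge0 d_neg; rewrite /A_step /=.
have i1_gt1 : (1 < i1)%N.
  have := inv_d1 inv; have := d_pos i1; rewrite -/d.
  case: (eqVneq i1 1%N) => [->|]; lia.
(* After [i2], [d] falls from positive to nonpositive while the row sums do not increase, so [b]
   drops there. *)
have [j0 j0J cj0] : exists2 j, j \in J & ent c j = i2%:Z.
  apply: bsum_drop; have := @inv_mono _ _ _ _ _ _ inv i2.
  move: d_i2 (d_pos i2); rewrite !dE; lia.
have Pj0 : i1%:Z <= ent c j0 <= i2%:Z by rewrite cj0; lia.
have [] := @greatestP J (fun j => i1%:Z <= ent c j <= i2%:Z) j0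
  (inv_sorted inv) j0J Pj0.
set j := greatest _ _ => jJ; have jn := inv_range inv jJ.
rewrite !(cnE c_range jn) => cj j_max.
have sE : absz ((cn c j)%:Z - i1%:Z + 1) = (cn c j + 1 - i1)%N by lia.
rewrite {}sE; set s := (cn c j + 1 - i1)%N.
have s_gt0 : (0 < s)%N by rewrite /s; lia.
have a_gt0 : (0 < i3)%N by lia.
(* [cn c j <= i2] and the comparison of block lengths give [i3 + s - 1 <= i4]. *)
have a_s : (i3 + s <= m.+1)%N by rewrite /s; lia.
have z_neg i : (i3 <= i <= i3 + s - 1)%N -> d i < 0.
  by move=> iz; apply: d_neg; move: iz; rewrite /s; lia.
have z_gt0 : 0 < ent rr (i3 + s - 1).
  by have := z_neg (i3 + s - 1)%N; rewrite dE; lia.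
have := A_rows (inv_mono inv) s_gt0 a_gt0 a_s rr_last z_gt0.
set I := (if _ then _ else _) => -[I_uniq [I_size [u [v [e]]]]].
move=> [I_mem [au uv ve em ze] u_drop e_drop flat].
have e_neg i : (i3 <= i <= e)%N -> d i < 0.
  move=> ie; have [iz|zi] := leqP i (i3 + s - 1)%N; first by apply: z_neg; lia.
  apply: le_lt_trans (z_neg (i3 + s - 1)%N _); last lia.
  by apply: d_le_flat; rewrite ?flat //; lia.
have col_mem i : (i \in rng 1 (i1 - 1) ++ I) =
    [|| 1 <= i < i1, i3 <= i < u | v <= i <= e]%N.
  by rewrite mem_cat I_mem mem_rng; congr (_ || _); lia.
have Ineg i : i \in I -> (i3 <= i <= m)%N /\ d i < 0.
  by rewrite I_mem => iI; split; [lia|apply: e_neg; lia].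
exists (rng i1 (cn c j)), I; split=> //.
- by move=> i; rewrite mem_rng => ij; split; [lia|apply: d_pos; lia].
- by move=> i /Ineg[im di]; split=> //; lia.
- exact: rng_uniq.
- by rewrite size_rng I_size /s; lia.
- by move=> i; rewrite mem_cat !mem_rng; congr (_ || _); lia.
(* Only a row inside the column followed by one outside matters: [i1.-1], [u.-1] or [e]. At [i1.-1]
   the row sums drop because [d] rises from 0 while [b] does not increase. *)
- move=> i i_gt0; have := inv_mono inv i_gt0.
  case: (boolP (i \in _)); last by case: (_ \in _) => _; clear; lia.
  case: (boolP (i.+1 \in _)); first by clear; lia.
  rewrite !col_mem => i1col icol rr_i.
  suff : ent rr i.+1 < ent rr i by clear; lia.
  have [e1|e1] := eqVneq i i1.-1.
    have := d_zero i; have := d_pos i1; have := bsumS c J i.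
    have -> : i1 = i.+1 by lia.
    rewrite !dE; lia.
  have [->|e2] := eqVneq i e; first exact: e_drop.
  have [e3|e3] := eqVneq i u.-1; last by clear -icol i1col e1 e2 e3 i1_gt1; lia.
  have u_pos : (i3 < u)%N.
    by clear -icol i1col e1 e2 e3 i1_gt1 au uv ve a_gt0; lia.
  by have [_] := u_drop u_pos; have -> : u = i.+1 by lia.
(* The lists name all possible change positions: four if the first interval of [I] is empty, and
   otherwise six, where [s > 1]. Both fit into [2 + 2 * s]. *)
- rewrite size_rng; have -> : ((cn c j).+1 - i1 = s)%N by rewrite /s; lia.
  have [ui|iu] := leqP u i3.
    apply: leq_trans (_ : size [:: 0; i1.-1; v.-1; e]%N <= _)%N; last first.
      by rewrite /=; lia.
    apply: edges_le => i im.
  rewrite [mem _ i]col_mem [mem _ i.+1]col_mem !inE.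
    clear -i1_gt1 i12 i34 ui au uv ve; lia.
  have [s_gt1 _] := u_drop iu.
  apply: leq_trans (_ : size [:: 0; i1.-1; i3.-1; u.-1; v.-1; e]%N <= _)%N; last first.
    by rewrite /=; lia.
  apply: edges_le => i im.
  rewrite [mem _ i]col_mem [mem _ i.+1]col_mem !inE.
  clear -i1_gt1 i12 i34 iu au uv ve; lia.
- exists i3, e; split=> // i; rewrite ?mem_rng ?I_mem; lia.
(* A right neighbour in a remaining column would make [j.+1] a larger candidate; in a final column
   it would yield, by [inv_pos], a row of the positive block with [d <= 0]. *)
- left=> i; rewrite mem_rng => ij; apply/negP => Xi.
  have /andP[_ jn1] := inv_support inv Xi.
  have [j1J|j1J] := boolP (j.+1 \in J).
    have := j_max _ j1J; rewrite (cnE c_range jn1).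
    move: Xi; rewrite (inv_unused inv) //.
    have := @cn_mono j j.+1; lia.
  have jp : (j < j.+1 <= n)%N by lia.
  have di : 0 < d i by apply: d_pos; lia.
  have ij' : (i <= cn c j)%N by lia.
  have [e' e'j] := inv_pos inv jJ jp j1J di ij' Xi.
  have := d_pos e'; rewrite /d; lia.
- move=> i p pJ pj di ip; rewrite mem_cat mem_rng => /orP[i_lt|/Ineg[]].
    by have := d_zero i; move: di; rewrite -/d; lia.
  by move: di; rewrite -/d; lia.
(* Remaining columns to the right of [j] are shorter than [i1], since [j] is the last candidate. *)
- move=> i p pJ jp di ip _; exists i1; last by apply: ltW; apply: d_pos; lia.
  have pn := inv_range inv pJ.
  have := j_max _ pJ; rewrite (cnE c_range pn).
  have := @cn_mono j p; have := d_ge0 i; have := d_pos i; move: di; rewrite -/d.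
  lia.
Qed.

Lemma B_step_spec i1 i2 i3 i4 :
  (1 <= i1 <= i2)%N -> (i2 < i3 <= i4)%N -> (i4 <= m)%N ->
  (i4 - i3 < i2 - i1)%N ->
  (forall i, (i1 <= i <= i2)%N -> 0 < d i) ->
  (forall i, (i < i1)%N -> d i = 0) -> (forall i, (i < i3)%N -> 0 <= d i) ->
  (forall i, (i3 <= i <= i4)%N -> d i < 0) -> 0 <= d i4.+1 ->
  exists P Q, step_spec m c J rr X (B_step m c J rr i2 i3 i4).1
    (B_step m c J rr i2 i3 i4).2 P Q.
Proof.
move=> i12 i34 i4m size_lt d_pos d_zero d_ge0 d_neg d_i4; rewrite /B_step /=.
have i1_gt1 : (1 < i1)%N.
  have := inv_d1 inv; have := d_pos i1; rewrite -/d.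
  case: (eqVneq i1 1%N) => [->|]; lia.
have [j0 j0J cj0] : exists2 j, j \in J & ent c j = i3.-1%:Z.
  apply: bsum_drop; have := @inv_mono _ _ _ _ _ _ inv i3.-1.
  have := d_neg i3; have := d_ge0 i3.-1; rewrite prednK ?dE; lia.
have Pj0 : i3%:Z <= ent c j0 + 1 <= i4%:Z by rewrite cj0; lia.
have [] := @leastP J (fun j => i3%:Z <= ent c j + 1 <= i4%:Z) j0
  (inv_sorted inv) j0J Pj0.
set j := least _ _ => jJ; have jn := inv_range inv jJ.
rewrite !(cnE c_range jn) => cj j_min.
have sE : absz (i4%:Z - (cn c j)%:Z) = (i4 - cn c j)%N by lia.
rewrite {}sE; set s := (i4 - cn c j)%N.
have s_gt0 : (0 < s)%N by rewrite /s; lia.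
have s_lt : (s < i2)%N by rewrite /s; lia.
have z_pos i : (i2 + 1 - s <= i <= i2)%N -> 0 < d i.
  by move=> iz; apply: d_pos; move: iz; rewrite /s; lia.
have z_gt1 : (1 < i2 + 1 - s)%N by rewrite /s; lia.
have f0 : ent rr 0 <= ent rr 1 by apply: rr_ge0; lia.
(* At this row [d > 0], so its sum is below its [b], hence below [b_1], which equals [r_1] by
   [inv_d1]. *)
have f1 : ent rr (i2 + 1 - s) < ent rr 1.
  have := z_pos (i2 + 1 - s)%N; have := inv_d1 inv; rewrite -/d !dE; try lia.
  by have := @bsum_le c J 1 (i2 + 1 - s); lia.
have := B_rows (inv_mono inv) s_gt0 s_lt f0 f1.
set I := (if _ then _ else _) => -[I_uniq [I_size [v [w [u]]]]].
move=> [I_mem [v_gt1 vw wu ub vz] u_drop v_drop flat].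
have Ipos i : i \in I -> (v <= i <= i2)%N /\ 0 < d i.
  rewrite I_mem => iI; split; first lia.
  have [iz|zi] := leqP i (i2 + 1 - s)%N; last by apply: z_pos; lia.
  apply: lt_le_trans (z_pos (i2 + 1 - s)%N _) _; first lia.
  by apply: d_le_flat; rewrite ?flat //; lia.
set col := _ ++ _.
(* All rows of [I] are at most [i2], and [i2 <= cn c j]. *)
have col_mem i : (i \in col) = (1 <= i <= i4)%N && (i \notin I).
  rewrite mem_cat !mem_filter !mem_rng; have := Ipos i.
  by case: (i \in I) => Ii; [have [//|] := Ii|]; lia.
exists I, (rng (cn c j).+1 i4); split=> //.
- by move=> i /Ipos[im di]; split=> //; lia.
- by move=> i; rewrite mem_rng => ij; split; [lia|apply: d_neg; lia].
- exact: rng_uniq.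
- by rewrite size_rng I_size /s; lia.
- move=> i; rewrite col_mem mem_rng; have := Ipos i.
  by case: (i \in I) => Ii; [have [//|] := Ii|]; lia.
- move=> i i_gt0; have := inv_mono inv i_gt0.
  case: (boolP (i \in _)); last by case: (_ \in _) => _; clear; lia.
  case: (boolP (i.+1 \in _)); first by clear; lia.
  rewrite !col_mem !I_mem => i1col icol rr_i.
  suff : ent rr i.+1 < ent rr i by clear; lia.
  (* At [i4] the row sums drop because [d] rises from negative to nonnegative while [b] does not
     increase; if [i4 = m], the next row sum is the default 0. *)
  have [e1|e1] := eqVneq i i4.
    have := d_neg i4; have := bsumS c J i4; have := d_i4; rewrite e1.
    have [i4_lt|] := ltnP i4 m; first by rewrite !dE; lia.
    move=> mi; have -> : i4 = m by lia.
    by rewrite rr_last [d m]dE; lia.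
  have [e2|e2] := eqVneq i v.-1.
    by move: v_drop; have -> : v = i.+1 by lia.
  have e3 : i = u by clear -icol i1col e1 e2 i12 i34 v_gt1 vw wu ub; lia.
  have u_lt : (u < i2)%N by clear -icol i1col e1 e2 e3 i12 i34 v_gt1 vw wu ub; lia.
  by have [_] := u_drop u_lt; rewrite e3.
- rewrite I_size; have [iu|ui] := leqP i2 u.
    apply: leq_trans (_ : size [:: 0; i4; v.-1; w]%N <= _)%N; last first.
      by rewrite /=; lia.
    apply: edges_le => i im.
    rewrite [mem _ i]col_mem [mem _ i.+1]col_mem !I_mem !inE.
    clear -i12 i34 v_gt1 vw wu ub iu; lia.
  have [s_gt1 _] := u_drop ui.
  apply: leq_trans (_ : size [:: 0; i4; v.-1; w; u; i2]%N <= _)%N; last first.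
    by rewrite /=; lia.
  apply: edges_le => i im.
  rewrite [mem _ i]col_mem [mem _ i.+1]col_mem !I_mem !inE.
  clear -i12 i34 v_gt1 vw wu ub; lia.
- exists i3, i4; split=> // i; rewrite ?mem_rng ?I_mem; lia.
- right=> i; rewrite mem_rng => ij; apply: contraT => Xi.
  (* Column 1 has full length [m], so no row can be added to it and it is never selected here. *)
  have j_gt1 : (1 < j)%N.
    have [j1|] := eqVneq j 1%N; last by lia.
    by move: c_1; rewrite -j1 (cnE c_range jn); lia.
  have j1n : (1 <= j.-1 <= n)%N by lia.
  (* A remaining column [j.-1] without row [i] would be an earlier candidate; a final one would
     yield, by [inv_neg], a row of the negative block with [0 <= d]. *)
  have [j1J|j1J] := boolP (j.-1 \in J).
    have := j_min _ j1J; rewrite (cnE c_range j1n).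
    move: Xi; rewrite (inv_unused inv) //.
    have := @cn_mono j.-1 j; lia.
  have jp : (1 <= j.-1 < j)%N by lia.
  have di : d i < 0 by apply: d_neg; lia.
  have ij' : (cn c j < i)%N by lia.
  have [e' e'j] := inv_neg inv jJ jp j1J di ij' Xi.
  have := d_neg e'; rewrite /d; lia.
- move=> i p pJ pj; rewrite -/d col_mem => di ip /andP[i_le iI].
  (* Remaining columns to the left of [j] have length at least [i4], since [j] is the first
     candidate. *)
  exists i4; last by apply: ltW; apply: d_neg; lia.
  have pn := inv_range inv pJ.
  have := j_min _ pJ; rewrite (cnE c_range pn).
  have := @cn_mono p j; have := d_neg i; move: di; clear -pj pn jn i_le cj i34.
  lia.
- move=> i p pJ jp; rewrite -/d col_mem => di ip iI; exists i4.+1 => //.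
  have pn := inv_range inv pJ.
  have := @cn_mono j p; have i_gt : (i3 <= i)%N by have := d_ge0 i; lia.
  have : i != i4.+1 by apply: contraTneq di => ->; lia.
  have iI' : i \notin I by apply/negP => /Ipos[]; lia.
  move: iI; rewrite iI' andbT; clear -i_gt jp pn jn cj i34; lia.
Qed.

Lemma d_signs : ~~ all (fun i => d i == 0) (rng 1 m) ->
  (exists2 i, (1 <= i <= m)%N & 0 < d i) /\
  (exists2 i, (1 <= i <= m)%N & d i < 0).
Proof.
move=> nz; have total : \sum_(i <- rng 1 m) d i = 0 := inv_total inv.
split.
- have [/hasP[i]|/hasPn none] := boolP (has (fun i => 0 < d i) (rng 1 m)).
    by rewrite mem_rng; exists i.
  case/negP: nz; move/eqP: total; rewrite -oppr_eq0 -sumrN psumr_eq0 => [|i _].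
    by apply: sub_all => i /=; rewrite oppr_eq0.
  have := none i; rewrite mem_rng; have := @d_out i; lia.
- have [/hasP[i]|/hasPn none] := boolP (has (fun i => d i < 0) (rng 1 m)).
    by rewrite mem_rng; exists i.
  case/negP: nz; move/eqP: total; rewrite psumr_eq0 // => i _.
  have := none i; rewrite mem_rng; have := @d_out i; lia.
Qed.

Lemma step_exists : ~~ all (fun i => d i == 0) (rng 1 m) ->
  exists P Q, step_spec m c J rr X (step m c J rr).1 (step m c J rr).2 P Q.
Proof.
move=> /d_signs[[x xm dx] [y ym dy]].
have dm : d m.+1 = 0 by apply: d_out; lia.
have [||] := @block_bounds m (fun i => 0 < d i)
  (fun i => (0 < d i) && (d i.+1 <= 0)) x xm dx; rewrite /= ?dm //.
  by move=> i; rewrite leNgt.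
have [||] := @block_bounds m (fun i => d i < 0)
  (fun i => (d i < 0) && (0 <= d i.+1)) y ym dy; rewrite /= ?dm //.
  by move=> i; rewrite leNgt.
rewrite /step -/d /=.
set i1 := least _ (fun i => 0 < d i); set i2 := least _ (fun i => _ && (_ <= 0)).
set i3 := least _ (fun i => d i < 0); set i4 := least _ (fun i => _ && (0 <= _)).
move=> i34 i4m d_neg d_i4 d_ge0 i12 i2m d_pos d_i2 d_le0.
(* If a negative [d] came first, the prefix sum up to [i3] would be negative, against
   [inv_prefix]. *)
have i13 : (i1 < i3)%N.
  rewrite ltnNge; apply/negP => i31; have di3 := d_neg i3 ltac:(lia).
  have := inv_prefix inv (k := i3) ltac:(lia); rewrite big_nat_recr /=; last by lia.
  rewrite -/d leNgt => /negP; apply; apply: ltr_wnDl di3.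
  by rewrite big_nat; apply: sumr_le0 => i ii; rewrite leNgt; apply: d_le0; lia.
have i23 : (i2 < i3)%N.
  by rewrite ltnNge; apply/negP => i32; have := d_pos i3; have := d_neg i3; lia.
have d_ge0' i : (i < i3)%N -> 0 <= d i.
  have [->|i0] := eqVneq i 0%N; first by rewrite d_out.
  by move=> ii; rewrite leNgt; apply: d_ge0; lia.
have d_zero i : (i < i1)%N -> d i = 0.
  have [->|i0] := eqVneq i 0%N; first by rewrite d_out.
  move=> ii; have := d_ge0' i; have := d_le0 i; lia.
rewrite -leNgt in d_i4; rewrite -leNgt in d_i2.
rewrite !size_rng; case: ifP => /= [le|gt].
- by apply: (@A_step_spec i1 i2 i3 i4) => //; lia.
- by apply: (@B_step_spec i1 i2 i3 i4) => //; lia.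
Qed.

End State.

End Steps.

(** * The whole procedure *)

Lemma edges_initial k b : (edges k (fun i => (1 <= i <= b)%N) <= 2)%N.
Proof.
by apply: (@edges_le _ _ [:: 0; b]%N) => i _; rewrite !inE; lia.
Qed.

Section Run.
Variables (m n : nat) (c : seq int).
Hypothesis c_range : forall j, (1 <= j <= n)%N -> 0 <= ent c j <= m%:Z.
Hypothesis c_mono : forall j k, (1 <= j)%N -> (j <= k)%N -> (k <= n)%N ->
  ent c k <= ent c j.
Hypothesis c_1 : ent c 1 = m%:Z.

Lemma mem_remaining J i j :
  ((i, j) \in remaining m c J) =
  [&& j \in J, (1 <= i <= m)%N & i%:Z <= ent c j].
Proof.
apply/allpairsPdep/and3P => [[q [p [qJ]]]|[jJ im ij]].
  by rewrite mem_filter mem_rng => /andP[pc pm] [-> ->].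
by exists j, i; rewrite mem_filter mem_rng im ij.
Qed.

Lemma eq_row_edges X Y : (forall i j, X i j = Y i j) ->
  row_edges m n X = row_edges m n Y.
Proof. by move=> XY; apply: eq_bigr => i _; apply: eq_edges. Qed.

Lemma eq_col_edges J X Y : (forall i j, X i j = Y i j) ->
  col_edges m n J X = col_edges m n J Y.
Proof.
by move=> XY; apply: eq_bigr => j _; case: ifP => // _; apply: eq_edges.
Qed.

(** [Y] is the final configuration seen from an intermediate state. Edge count plus discrepancy
    never increases along the run, because each step pays for its new edges. *)
Lemma run_edges k J rr X (Y : nat -> pred nat) :
  state_inv m n c J rr X -> (size J <= k)%N ->
  (forall i j, Y i j = if j \in J then (i, j) \in run m c k J rr else X i j) ->
  [/\ forall p, p \in run m c k J rr -> p.2 \in J,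
      forall i j, Y i j -> (1 <= i <= m)%N && (1 <= j <= n)%N,
      (row_edges m n Y <= row_edges m n X + discrepancy m c J rr)%N
    & (col_edges m n [::] Y <= col_edges m n J X + discrepancy m c J rr)%N].
Proof.
have stop J' rr' X' (Y' : nat -> pred nat) : state_inv m n c J' rr' X' ->
    (forall i j,
       Y' i j = if j \in J' then (i, j) \in remaining m c J' else X' i j) ->
    [/\ forall p, p \in remaining m c J' -> p.2 \in J',
      forall i j, Y' i j -> (1 <= i <= m)%N && (1 <= j <= n)%N,
      (row_edges m n Y' <= row_edges m n X' + discrepancy m c J' rr')%N
    & (col_edges m n [::] Y' <= col_edges m n J' X' + discrepancy m c J' rr')%N].
  move=> inv Y'E; have YX i j : Y' i j = X' i j.
    rewrite Y'E mem_remaining; case: ifP => //= jJ.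
    have jn := inv_range inv jJ; rewrite (inv_unused inv) // (cnE c_range jn).
    by have := cn_le c_range jn; lia.
  split; first by move=> [i j]; rewrite mem_remaining => /and3P[].
  - by move=> i j; rewrite YX; apply: (inv_support inv).
  - by rewrite (eq_row_edges YX) leq_addr.
  - apply: leq_trans (leq_addr _ _); rewrite (eq_col_edges _ YX).
    apply: leq_sum => j _ /=; case: ifP => // jJ.
    rewrite (@eq_edges _ _ (fun i => (1 <= i <= cn c j)%N)) ?edges_initial // => i.
    exact: (inv_unused inv).
elim: k J rr X Y => [|k IH] J rr X Y inv Jk /=.
  by case: ifP => _ YE; apply: stop.
case: ifP => [_ YE|/negbT nz]; first exact: stop.
have [P [Q]] := step_exists c_range c_mono c_1 inv nz.
case: step => j col /= spec YE.
have jJ := step_mem spec.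
have restE (q : nat) : (q \in rem j J) = (q != j) && (q \in J) := mem_rest j inv q.
have inv' := inv_step c_range inv spec.
have Jk' : (size (rem j J) <= k)%N by rewrite size_rem //; case: (size J) Jk.
have Y'E (i q : nat) : Y i q = if q \in rem j J
    then (i, q) \in run m c k (rem j J) (update m rr col) else recol X j col i q.
  (* This first use of [IH] only serves to show that later steps place no points in column [j]. *)
  have [run_cols _ _ _] := IH _ _ _ _ inv' Jk' (fun _ _ => erefl).
  rewrite YE restE mem_cat /recol; have [->|qj] /= := eqVneq q j.
    rewrite jJ; have -> : ((i, j) \in [seq (i, j) | i <- col]) = (i \in col).
      by rewrite mem_map // => x y [].
    case: (boolP (_ \in run _ _ _ _ _)) => [/run_cols|_]; last by rewrite orbF.
    by rewrite restE eqxx.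
  case: ifP => // _; case: (boolP (_ \in map _ _)) => // /mapP[x _ [_ e]].
  by rewrite e eqxx in qj.
have [run_cols Ysup rowY colY] := IH _ _ _ _ inv' Jk' Y'E.
have disc := discrepancy_step c_range inv spec.
split=> //.
- move=> p; rewrite mem_cat => /orP[/mapP[i _ ->] //|/run_cols].
  by rewrite restE => /andP[].
- have := row_edges_step c_range inv spec; lia.
- have := col_edges_step inv spec; lia.
Qed.

End Run.

(** * From [L_h] and [L_v] to changes along columns and rows *)

(** [f] recovers a boundary pair from the line and the position of its change, so there are at most
    as many pairs as changes. *)
Lemma card_fset_set_edges (T : choiceType) (A : set T) M N
    (Z : nat -> pred nat) (f : nat -> nat -> T) : finite_set A ->
  (forall x, A x -> exists i j,
    [/\ (1 <= i <= M)%N, (j <= N)%N, Z i j != Z i j.+1 & x = f i j]) ->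
  (#|` fset_set A| <= \sum_(1 <= i < M.+1) edges N (Z i))%N.
Proof.
move=> finA AE.
pose s := [seq f i j | i <- rng 1 M,
                       j <- [seq j <- iota 0 N.+1 | Z i j != Z i j.+1]].
have -> : (\sum_(1 <= i < M.+1) edges N (Z i) = size s)%N.
  rewrite size_allpairs_dep sumnE big_map; apply: eq_bigr => i _.
  by rewrite size_filter -sum1_count /edges -big_mkcond.
apply: (@leq_trans #|` [fset x in s]%fset|).
  apply/fsubset_leq_card/fsubsetP => x; rewrite in_fset_set // => /set_mem/AE.
  move=> [i [j [iM jN Zij ->]]]; rewrite inE; apply/allpairsPdep; exists i, j.
  by rewrite mem_filter mem_rng Zij mem_iota.
by rewrite card_fseq size_undup.
Qed.

Section Boundary.
Variables (m n : nat) (F : {fset int * int}) (Y : nat -> pred nat).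
Hypothesis Y_support : forall i j, Y i j -> (1 <= i <= m)%N && (1 <= j <= n)%N.
Hypothesis YF : forall i j, Y i j -> (i%:Z, j%:Z) \in F.
Hypothesis FY : forall p, p \in F -> exists i j, Y i j /\ p = (i%:Z, j%:Z).

Lemma L_v_le : (L_v F <= row_edges m n Y)%N.
Proof.
(* The lines are the rows; the conditional puts the point inside [F] first. *)
apply: (@card_fset_set_edges _ _ m n Y (fun i j =>
  let p := ((i%:Z, j%:Z), (i%:Z, j.+1%:Z)) in if Y i j then p else (p.2, p.1))).
  exact: finite_v_boundary.
move=> [[a b] [a' b']] [/= <- /norm_diff1 b'E /FY[i [j [Yij [-> bE]]]] ab'].
have ij := Y_support Yij; have nY q : b' = q%:Z -> Y i q = false.
  by move=> b'q; apply: contraNF ab' => /YF; rewrite b'q.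
case: b'E; rewrite bE => b'E.
- have {}b'E : b' = j.-1%:Z by lia.
  exists i, j.-1; rewrite prednK ?(nY _ b'E) ?Yij ?b'E; last by lia.
  by split=> //; lia.
- have {}b'E : b' = j.+1%:Z by lia.
  exists i, j; rewrite (nY _ b'E) Yij b'E.
  by split=> //; lia.
Qed.

Lemma L_h_le : (L_h F <= col_edges m n [::] Y)%N.
Proof.
apply: (@card_fset_set_edges _ _ n m (fun j i => Y i j) (fun j i =>
  let p := ((i%:Z, j%:Z), (i.+1%:Z, j%:Z)) in if Y i j then p else (p.2, p.1))).
  exact: finite_h_boundary.
move=> [[a b] [a' b']] [/= /norm_diff1 a'E <- /FY[i [j [Yij [aE ->]]]] ab'].
have ij := Y_support Yij; have nY q : a' = q%:Z -> Y q j = false.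
  by move=> a'q; apply: contraNF ab' => /YF; rewrite a'q.
case: a'E; rewrite aE => a'E.
- have {}a'E : a' = i.-1%:Z by lia.
  exists j, i.-1; rewrite prednK ?(nY _ a'E) ?Yij ?a'E; last by lia.
  by split=> //; lia.
- have {}a'E : a' = i.+1%:Z by lia.
  exists j, i; rewrite (nY _ a'E) Yij a'E.
  by split=> //; lia.
Qed.

End Boundary.

(** * The initial state and its dominance conditions *)

Lemma sum_leq_minn k a : (\sum_(1 <= i < k.+1) (i <= a) = minn k a)%N.
Proof.
elim: k => [|k IH]; first by rewrite big_geq // min0n.
by rewrite big_nat_recr //= IH; lia.
Qed.

Lemma card_fset_map (T : choiceType) (F : {fset T}) (P : pred T)
    (f : nat -> T) (s : seq nat) : injective f -> uniq s ->
  (forall p, p \in F -> P p -> exists2 i, i \in s & p = f i) ->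
  (forall i, i \in s -> P (f i)) ->
  (#|` [fset p in F | P p]%fset| = \sum_(i <- s) (f i \in F))%N.
Proof.
move=> f_inj s_uniq Fs Ps.
have -> : [fset p in F | P p]%fset =
    [fset p in map f [seq i <- s | f i \in F]]%fset.
  apply/fsetP => p; rewrite !inE /=; apply/andP/mapP => [[pF Pp]|[i]].
    by have [i si pE] := Fs p pF Pp; exists i; rewrite // mem_filter -pE pF.
  by rewrite mem_filter => /andP[fF si] ->; rewrite fF Ps.
rewrite card_fseq undup_id ?size_map ?size_filter -?sum1_count ?big_mkcond //.
by rewrite map_inj_uniq ?filter_uniq.
Qed.

Section Initial.
Variables (m n : nat) (r c : seq int).
Lemma alphaE : 2 * alpha m n r c = (discrepancy m c (rng 1 n) r)%:R.
Proof.
rewrite /alpha mulrC divfK // pmulrn /discrepancy -natz natr_sum; congr (_%:~R).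
apply: eq_big_seq => i; rewrite mem_index_iota /dsum => im.
have -> : (1 <= i <= m)%N by lia.
by rewrite natz abszE distrC.
Qed.

Hypothesis c_1 : ent c 1 = m%:Z.
Hypothesis c_noninc : forall j : nat, (1 <= j < n)%N -> ent c j.+1 <= ent c j.
Hypothesis rc_consistent : consistent m n r c.

Lemma c_mono j k : (1 <= j)%N -> (j <= k)%N -> (k <= n)%N -> ent c k <= ent c j.
Proof.
by move=> j1 jk kn; apply: (@noninc_le (ent c) 1 n) => // i; apply: c_noninc.
Qed.

Lemma consistent_matrix : exists Z : nat -> pred nat,
  (forall i, (1 <= i <= m)%N -> ent r i = (\sum_(1 <= j < n.+1) Z i j)%N%:Z) /\
  (forall j, (1 <= j <= n)%N -> ent c j = (\sum_(1 <= i < m.+1) Z i j)%N%:Z).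
Proof.
have [F [F_range rF cF]] := rc_consistent.
exists (fun i j => (i%:Z, j%:Z) \in F); split=> [i im|j jn].
- rewrite -rF // /row_sum.
  rewrite (@card_fset_map _ F _ (fun j : nat => (i%:Z, j%:Z)) (rng 1 n)) //.
  + by move=> x y [].
  + exact: rng_uniq.
  + move=> [a b] /F_range /= ab /eqP ->; exists (absz b).
      by rewrite mem_rng; lia.
    by congr (_, _); lia.
- rewrite -cF // /col_sum.
  rewrite (@card_fset_map _ F _ (fun i : nat => (i%:Z, j%:Z)) (rng 1 m)) //.
  + by move=> x y [].
  + exact: rng_uniq.
  + move=> [a b] /F_range /= ab /eqP ->; exists (absz a).
      by rewrite mem_rng; lia.
    by congr (_, _); lia.
Qed.

Lemma c_range j : (1 <= j <= n)%N -> 0 <= ent c j <= m%:Z.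
Proof.
move=> jn; rewrite -c_1 c_mono ?andbT; try lia.
by have [Z [_ ->]] := consistent_matrix.
Qed.

(** The necessary half of Gale-Ryser: [b_1 + ... + b_k] is the sum of the [minn k (cn c j)], and the
    first [k] rows of column [j] hold at most that many points, with equality for [k = m]. *)
Lemma prefix_sums (k : nat) : (k <= m)%N ->
  0 <= \sum_(1 <= i < k.+1) dsum m c (rng 1 n) r i /\
  (k = m -> \sum_(1 <= i < k.+1) dsum m c (rng 1 n) r i = 0).
Proof.
move=> km; have [Z [rZ cZ]] := consistent_matrix.
have -> : \sum_(1 <= i < k.+1) dsum m c (rng 1 n) r i =
    (\sum_(1 <= j < n.+1) minn k (cn c j))%N%:Z -
    (\sum_(1 <= j < n.+1) \sum_(1 <= i < k.+1) Z i j)%N%:Z.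
  rewrite (eq_big_seq (fun i => (\sum_(1 <= j < n.+1) (i <= cn c j))%N%:R -
    (\sum_(1 <= j < n.+1) Z i j)%N%:R)) => [|i]; last first.
    rewrite mem_index_iota => ik; rewrite /dsum; have -> : (1 <= i <= m)%N by lia.
    rewrite rZ ?natz; last lia.
    congr (Posz _ - _); rewrite /bsum -sum1_count big_mkcond.
    by apply: eq_big_seq => j; rewrite mem_rng => /(cnE c_range)->.
  rewrite sumrB -!natr_sum !natz; congr (Posz _ - Posz _); last exact: exchange_big.
  by rewrite exchange_big; apply: eq_bigr => j _; rewrite sum_leq_minn.
have Zk j : (\sum_(1 <= i < k.+1) Z i j <= k)%N.
  rewrite -[leqRHS]muln1 -[X in (X * _)%N](subn1 k.+1) -sum_nat_const_nat.
  by apply: leq_sum => i _; case: (Z i j).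
have cnZ j : (1 <= j <= n)%N -> cn c j = (\sum_(1 <= i < m.+1) Z i j)%N.
  by move=> /cZ; rewrite /cn => ->.
split=> [|km'].
  rewrite subr_ge0 lez_nat big_nat [leqRHS]big_nat; apply: leq_sum => j jn.
  rewrite leq_min Zk cnZ // (@big_cat_nat _ _ _ k.+1 1 m.+1) //=.
  exact: leq_addr.
apply/eqP; rewrite subr_eq0 eqz_nat km'; apply/eqP; apply: eq_big_nat => j jn.
by have := cn_le c_range jn; rewrite cnZ // => /minn_idPr.
Qed.

(** The uniquely determined neighbour [F_1]. *)
Definition initial (i j : nat) := (1 <= j <= n)%N && (1 <= i <= cn c j)%N.

(** The column sums do not increase, so each row of [F_1] is an initial interval; its length [b] is
    found by induction on the number of columns. *)
Lemma row_edges_initial : (row_edges m n initial <= 2 * m)%N.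
Proof.
have row i : (edges n (initial i) <= 2)%N.
  have [b bE] : exists b, forall j, initial i j = (1 <= j <= b)%N; last first.
    by rewrite (eq_edges _ bE) edges_initial.
  case: i => [|i]; first by exists 0%N => j; rewrite /initial; lia.
  suff : forall k, (k <= n)%N -> exists b, forall j,
      (1 <= j <= k)%N && (i < cn c j)%N = (1 <= j <= b)%N.
    by move=> /(_ n (leqnn n))[b bE]; exists b => j; rewrite -bE.
  elim=> [|k IH] kn; first by exists 0%N => j; lia.
  have [b bE] := IH (ltnW kn); have [ik|ki] := ltnP i (cn c k.+1).
    exists k.+1 => j; have := @cn_mono m n c c_range c_mono j k.+1; lia.
  exists b => j; rewrite -bE; have [->|] := eqVneq j k.+1; lia.
apply: leq_trans (leq_sum _ (fun i _ => row i)) _.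
by rewrite sum_nat_const_nat subn1 mulnC.
Qed.

Lemma col_edges_initial : col_edges m n (rng 1 n) initial = (2 * n)%N.
Proof.
rewrite /col_edges (eq_big_seq (fun=> 2%N)) => [|j].
  by rewrite sum_nat_const_nat subn1 mulnC.
by rewrite /rng => ->.
Qed.

Hypothesis m_gt0 : (0 < m)%N.
Hypothesis r_size : size r = m.
Hypothesis r_1 : ent r 1 = n%:Z.
Hypothesis r_noninc : forall i : nat, (1 <= i < m)%N -> ent r i.+1 <= ent r i.

Lemma inv_initial : state_inv m n c (rng 1 n) r initial.
Proof.
split=> //.
- exact: rng_sorted.
- by move=> j; rewrite mem_rng.
(* Beyond [m] the entries are the default 0, and [r_m] is nonnegative as a count of points. *)
- move=> i i_gt0; have [im|mi] := ltnP i m; first by apply: r_noninc; lia.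
  rewrite [ent r i.+1]nth_default ?r_size //.
  have [->|im] := eqVneq i m.
    by have [Z [rZ _]] := consistent_matrix; rewrite rZ; lia.
  by case: i i_gt0 mi im => // i _ mi im; rewrite /= nth_default // r_size; lia.
(* Dominance for [k = 1] gives [b_1 >= r_1 = n], while [b_1] counts at most [n] columns. *)
- have [+ _] := prefix_sums m_gt0; rewrite big_nat1 /dsum.
  have -> : (1 <= 1 <= m)%N by lia.
  rewrite r_1.
  have := count_size (fun j => 1%:Z <= ent c j) (rng 1 n).
  by rewrite size_rng -/(bsum _ _ _); lia.
- by move=> k /prefix_sums[].
- by have [_ ->] := prefix_sums (leqnn m).
- by move=> i j; rewrite mem_rng /initial => ->.
- by move=> i j /andP[jn ij]; have := cn_le c_range jn; lia.
(* No column is final yet, so this condition and the next are vacuous. *)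
- by move=> i p q _ pq; rewrite mem_rng; lia.
- move=> i p q pJ pq; move: pJ; rewrite !mem_rng; lia.
Qed.

End Initial.

Unset Implicit Arguments.

Theorem theorem2 (m n : nat) (r : m.-tuple int) (c : n.-tuple int)
  (m_gt0 : (0 < m)%N) (n_gt0 : (0 < n)%N)
  (r_1 : ent r 1 = n%:Z)
  (r_noninc : forall i : nat, (1 <= i < m)%N -> ent r i.+1 <= ent r i)
  (c_1 : ent c 1 = m%:Z)
  (c_noninc : forall j : nat, (1 <= j < n)%N -> ent c j.+1 <= ent c j)
  (rc_consistent : consistent m n r c) :
  (L_h (F2 m n r c))%:R <= 2 * n%:R + 2 * alpha m n r c /\
  (L_v (F2 m n r c))%:R <= 2 * m%:R + 2 * alpha m n r c.
Proof.
have r_size := size_tuple r.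
have crange := c_range c_1 c_noninc rc_consistent.
have cmono := c_mono c_noninc.
have inv := inv_initial c_1 c_noninc rc_consistent m_gt0 r_size r_1 r_noninc.
pose Y i j := if j \in rng 1 n then (i, j) \in run m c n (rng 1 n) r
  else initial n c i j.
have Jn : (size (rng 1 n) <= n)%N by rewrite size_rng subn1.
have [run_cols Ysup rowY colY] :=
  run_edges crange cmono c_1 inv Jn (fun _ _ => erefl : Y _ _ = _).
(* For [j] outside [1..n] both sides are false, since the run only fills columns of its list. *)
have Yrun i j : Y i j = ((i, j) \in run m c n (rng 1 n) r).
  rewrite /Y; case: ifP => // /negbT jn.
  rewrite /initial -mem_rng (negPf jn); apply/esym/negbTE.
  by apply: contra jn => /run_cols.
have YF i j : Y i j -> (i%:Z, j%:Z) \in F2 m n r c.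
  by rewrite Yrun => ij; apply/imfsetP; exists (i, j).
have FY p : p \in F2 m n r c -> exists i j : nat, Y i j /\ p = (i%:Z, j%:Z).
  by case/imfsetP => -[i j] /= ij ->; exists i, j; rewrite Yrun.
rewrite !alphaE -!natrM -!natrD !ler_nat; split.
- apply: leq_trans (L_h_le Ysup YF FY) (leq_trans colY _).
  by rewrite col_edges_initial.
- apply: leq_trans (L_v_le Ysup YF FY) (leq_trans rowY _).
  by rewrite leq_add2r (row_edges_initial c_1 c_noninc rc_consistent).
Qed.
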